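(* Let $\alpha,\beta,\gamma$ be positive irrational real numbers with $\alpha+\beta+\gamma=1$. Then there exists a partition $\mathbb{N}=B_\alpha\cup B_\beta\cup \widetilde{B_\gamma}$ of $\mathbb{N}$ into the exact Beatty sequences $B_\alpha$, $B_\beta$ and an almost Beatty sequence $\widetilde{B_\gamma}$ of density $\gamma$ if and only if $$ r\alpha+s\beta=1 \quad\text{for some } r,s\in\mathbb{N}.$$ If this condition is satisfied, then $B_\alpha$ and $B_\beta$ are disjoint and $\widetilde{B_\gamma}=\mathbb{N}\setminus(B_\alpha\cup B_\beta)$ is an almost Beatty sequence of density $\gamma$ satisfying $$\|\widetilde{c}-c\|=\max\left(\left\lfloor \frac{2-\alpha}{1-\alpha}\right\rfloor,\left\lfloor \frac{2-\beta}{1-\beta}\right\rfloor\right),$$ where $c(n)=\lfloor n/\gamma\rfloor$ and $\widetilde{c}(n)$ denotes the $n$th element of $\widetilde{B_\gamma}$. More precisely, $$0\le c(n)-\widetilde{c}(n)\le \max\left(\left\lfloor \frac{2-\alpha}{1-\alpha}\right\rfloor,\left\lfloor \frac{2-\beta}{1-\beta}\right\rfloor\right)\quad (n\in\mathbb{N}),$$ and the upper bound is attained for infinitely many $n$. In particular, if $\max(\alpha,\beta)<1/2$, then $c(n)-\widetilde{c}(n)\in\{0,1,2\}$ for all $n\in\mathbb{N}$.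
   Context: $\mathbb{N}=\{1,2,3,\dots\}$. Subsets of $\mathbb{N}$ are identified with strictly increasing sequences of positive integers (their elements in increasing order). A partition of $\mathbb{N}$ is a collection of subsets such that every positive integer lies in exactly one of them. For $0<\alpha<1$, the Beatty sequence of density $\alpha$ is $B_\alpha=(\lfloor n/\alpha\rfloor)_{n\in\mathbb{N}}$. For sequences $a,b$ indexed by $\mathbb{N}$, $\|a-b\|=\sup\{|a(n)-b(n)|:n\in\mathbb{N}\}$. An almost Beatty sequence of density $\gamma$ is a strictly increasing sequence $(\widetilde{c}(n))_{n\in\mathbb{N}}$ of positive integers with $\|\widetilde{c}-c\|<\infty$, where $c(n)=\lfloor n/\gamma\rfloor$. *)

(* Defs.v *)
From mathcomp Require Import all_boot all_order all_algebra.
From mathcomp Require Import all_classical all_reals all_analysis.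

Set Implicit Arguments.
Unset Strict Implicit.
Unset Printing Implicit Defensive.

Import Order.TTheory GRing.Theory Num.Theory.

Local Open Scope classical_set_scope.
Local Open Scope ring_scope.

(* Here N = {1, 2, 3, ...}. A sequence indexed by N is represented by a function
   nat -> nat whose value at 0 is irrelevant: every notion below only looks at
   indices n > 0. *)
Definition posnat : set nat := [set n | (0 < n)%N].

Definition strictly_increasing (a : nat -> nat) : Prop :=
  forall m n : nat, posnat m -> posnat n -> (m < n)%N -> (a m < a n)%N.

Definition values (a : nat -> nat) : set nat := a @` posnat.

Definition enumerates (S : set nat) (a : nat -> nat) : Prop :=
  strictly_increasing a /\ values a = S.

(* The family is indexed, so that two equal nonempty members are not allowed. *)
Definition is_partition (I : Type) (F : I -> set nat) : Prop :=
  (forall i, F i `<=` posnat) /\ (forall m, posnat m -> exists! i, F i m).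

(* [Num.truncn] agrees with the floor on nonnegative reals. *)
Definition beatty {R : realType} (alpha : R) (n : nat) : nat :=
  Num.truncn (n%:R / alpha).

Definition beatty_set {R : realType} (alpha : R) : set nat :=
  values (beatty alpha).

Definition seq_dist (R : realType) (a b : nat -> nat) : \bar R :=
  ereal_sup [set (`|(a n)%:R - (b n)%:R|)%:E | n in posnat].

Definition almost_beatty {R : realType} (gamma : R) (ct : nat -> nat) : Prop :=
  [/\ strictly_increasing ct,
      values ct `<=` posnat
    & (seq_dist R ct (beatty gamma) < +oo)%E].

Definition almost_beatty_set {R : realType} (gamma : R) (S : set nat) : Prop :=
  exists2 ct : nat -> nat, almost_beatty gamma ct & values ct = S.

Definition max_deviation {R : realType} (alpha beta : R) : int :=
  Num.max (Num.floor ((2 - alpha) / (1 - alpha)))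
          (Num.floor ((2 - beta) / (1 - beta))).

(* Main.v *)
Require Import Defs.
From mathcomp Require Import all_boot all_order all_algebra.
From mathcomp Require Import all_classical all_reals all_analysis.
From mathcomp Require Import zify ring lra.

Import Order.TTheory GRing.Theory Num.Theory.

Local Open Scope classical_set_scope.
Local Open Scope ring_scope.

(* An integer m lies in both Beatty sequences exactly when, for k = m + 1, the
   point (k alpha, k beta) taken modulo Z^2 falls in the box
   (0, alpha) x (0, beta).  Let G be the subgroup of R^2 generated by Z^2 and
   (alpha, beta).  If 1, alpha, beta are linearly independent over Q then G is
   dense and meets the box.  Otherwise A alpha + B beta = C with integers of gcd
   g, and G is dense in every line A x + B y = j g.  When A B < 0 the line
   through 0 meets the box; when A, B > 0 the line A x + B y = g meets it unless
   C = g, which is the relation r alpha + s beta = 1.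

   Under this relation, let m be the nth element of the complement, k = m + 1,
   x = 1 - {k alpha} and y = 1 - {k beta}.  Counting the elements up to m gives
   n = k gamma + 1 - x - y, so that
   c(n) - m = 1 + floor((1 - x - y) / gamma), where 0 < x < 1 - alpha,
   0 < y < 1 - beta and r x + s y is a positive integer.  Hence x + y exceeds
   rho = 1 / max(r, s), this bound is approached by density, and the maximal
   deviation is the ceiling of (1 - rho) / gamma. *)

(** * Simultaneous Diophantine approximation *)

Lemma irrational_mul_int {R : realType} (a : R) (m p : int) :
  irrational a -> m%:~R * a = p%:~R -> m = 0.
Proof.
move=> irra map; apply/eqP; apply: contra_notT irra => m0.
exists (p%:~R / m%:~R) => //.
by rewrite fmorph_div /= !ratr_int -map mulrC mulKf // intr_eq0.
Qed.

Lemma intr_lt1_eq0 {R : numDomainType} (m : int) : `|m%:~R : R| < 1 -> m = 0.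
Proof. rewrite -intr_norm -[1]/(1%:~R) ltr_int; lia. Qed.

(** Pigeonhole: the K^2 + 1 points (i a, i b) modulo Z^2 fall into K^2 square cells of side 1/K < e,
    so two of them share a cell; n is the difference of their indices. *)
Lemma dirichlet_pair {R : realType} (a b e : R) : 0 < e ->
  exists (n : nat) (p q : int),
    [/\ (0 < n)%N, `|n%:R * a - p%:~R| < e & `|n%:R * b - q%:~R| < e].
Proof.
move=> e0; pose K := (Num.truncn e^-1).+1.
have Ke : e^-1 < K%:R by exact: truncnS_gt.
have K0 : 0 < K%:R :> R by rewrite ltr0n.
have fracK (x : R) : (Num.truncn (K%:R * (x - (Num.floor x)%:~R)) < K)%N.
  have /andP[fx xf] := floor_itv x; move: xf; rewrite intrD => xf.
  by rewrite truncn_lt_nat; nra.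
pose f (i : 'I_(K * K).+1) : 'I_K * 'I_K :=
  (Ordinal (fracK (i%:R * a)), Ordinal (fracK (i%:R * b))).
have : ~~ injectiveb f.
  apply/injectiveP => /leq_card; rewrite card_prod !card_ord.
  by rewrite ltnn.
case/injectivePn => i [j ji fij].
wlog lt_ij : i j ji fij / (i < j)%N.
  move=> W; have := ji; rewrite -val_eqE neq_ltn => /orP[] ij.
  - exact: (W i j).
  - by apply: (W j i) => //; rewrite eq_sym.
have close (x y : R) : Num.truncn (K%:R * (x - (Num.floor x)%:~R)) =
    Num.truncn (K%:R * (y - (Num.floor y)%:~R)) ->
  `|y - x - (Num.floor y - Num.floor x)%:~R| < e.
  move=> exy.
  have /andP[fx _] := floor_itv x; have /andP[fy _] := floor_itv y.
  have Kx : 0 <= K%:R * (x - (Num.floor x)%:~R) by rewrite mulr_ge0 ?subr_ge0.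
  have Ky : 0 <= K%:R * (y - (Num.floor y)%:~R) by rewrite mulr_ge0 ?subr_ge0.
  have /andP[] := truncn_itv Kx; have /andP[] := truncn_itv Ky.
  rewrite exy -natr1; set t := (Num.truncn _)%:R => h1 h2 h3 h4.
  have Ke1 : 1 < K%:R * e by rewrite -ltr_pdivrMr// mul1r.
  by rewrite intrB ltr_norml; apply/andP; split; nra.
exists (j - i)%N, (Num.floor (j%:R * a) - Num.floor (i%:R * a)),
  (Num.floor (j%:R * b) - Num.floor (i%:R * b)).
case: fij => fa fb.
by rewrite subn_gt0 (natrB _ (ltnW lt_ij)) !mulrBl; split=> //; exact: close.
Qed.

(* The point (x, y) lies in the closure of G. *)
Definition approximable {R : realType} (a b x y : R) : Prop :=
  forall e, 0 < e -> exists m p q : int,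
    `|m%:~R * a - p%:~R - x| < e /\ `|m%:~R * b - q%:~R - y| < e.

(** The index m may be negative. Adding j = |m| + K copies of a very short vector of G with index n
    >= 1 raises the index to at least K, and the precision e / 2 / (j + 1) keeps the total drift
    below e / 2. *)
Lemma approximable_large {R : realType} (a b x y e : R) (K : nat) :
  approximable a b x y -> 0 < e -> exists (k : nat) (p q : int),
    [/\ (K <= k)%N, `|k%:R * a - p%:~R - x| < e & `|k%:R * b - q%:~R - y| < e].
Proof.
move=> ab e0.
have [|m [p [q [xe ye]]]] := ab (e / 2); first lra.
pose j := (absz m + K)%N.
have j0 : 0 <= j%:R :> R by rewrite ler0n.
have [|n [p' [q' [n0 ae be]]]] := dirichlet_pair a b (e / 2 / (j%:R + 1)).
  by rewrite !divr_gt0//; lra.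
have [k km] : exists k : nat, k%:Z = m + j%:Z * n%:Z.
  by exists (absz (m + j%:Z * n%:Z)); nia.
have kR : k%:R = m%:~R + j%:R * n%:R :> R.
  by rewrite -[k%:R]/(k%:Z%:~R) km intrD intrM.
have bound (z w : R) : `|z| < e / 2 -> `|w| < e / 2 / (j%:R + 1) ->
    `|z + j%:R * w| < e.
  move=> ze; rewrite ltr_pdivlMr => [we|]; last lra.
  rewrite (le_lt_trans (ler_normD _ _))// normrM (ger0_norm j0).
  have := normr_ge0 w; nra.
exists k, (p + j%:Z * p'), (q + j%:Z * q'); rewrite kR !intrD !intrM; split.
- nia.
- by rewrite (_ : _ - x = (m%:~R * a - p%:~R - x) +
    j%:R * (n%:R * a - p'%:~R)); [exact: bound|ring].
- by rewrite (_ : _ - y = (m%:~R * b - q%:~R - y) +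
    j%:R * (n%:R * b - q'%:~R)); [exact: bound|ring].
Qed.

(* A short vector of G lies on the line [A x + B y = 0]; its multiples
   approximate every translate of that line through a point of G. *)
Lemma approximable_line {R : realType} (a b x y : R) (A B C m p q : int) :
  irrational a -> A%:~R * a + B%:~R * b = C%:~R -> B != 0 ->
  A%:~R * (x - (m%:~R * a - p%:~R)) + B%:~R * (y - (m%:~R * b - q%:~R)) = 0 ->
  approximable a b x y.
Proof.
move=> irra rel B0 line e e0.
set w1 := m%:~R * a - p%:~R in line; set w2 := m%:~R * b - q%:~R in line.
pose N : R := `|A%:~R| + `|B%:~R| + 1.
have A0 := normr_ge0 (A%:~R : R); have B0' := normr_ge0 (B%:~R : R).
have N0 : 0 < N by rewrite /N; lra.
(* The bound N^-1 puts the integer A u1 + B u2 strictly between -1 and 1, so it vanishes and the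
   short vector is parallel to the line. *)
have [|n [p' [q' [n0 ae be]]]] := dirichlet_pair a b (Num.min e N^-1).
  by rewrite lt_min e0 invr_gt0.
set u1 := n%:R * a - p'%:~R in ae; set u2 := n%:R * b - q'%:~R in be.
move: ae be; rewrite !lt_min => /andP[u1e u1N] /andP[u2e u2N].
have AuBu : A%:~R * u1 + B%:~R * u2 = (n%:Z * C - A * p' - B * q')%:~R.
  by rewrite /u1 /u2 !intrB !intrM -rel; ring.
have uline : A%:~R * u1 + B%:~R * u2 = 0.
  apply/eqP; rewrite AuBu intr_eq0; apply/eqP/(@intr_lt1_eq0 R); rewrite -AuBu.
  rewrite (le_lt_trans (ler_normD _ _))// !normrM.
  have NV : N^-1 * N = 1 by rewrite mulVf// gt_eqF.
  have NV0 : 0 < N^-1 by rewrite invr_gt0.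
  by move: NV; rewrite {2}/N => NV; nra.
have u10 : u1 != 0.
  apply: contraTneq n0 => /eqP; rewrite subr_eq0 => /eqP.
  by move=> /(irrational_mul_int _ n%:Z p' irra) [->].
have BR0 : B%:~R != 0 :> R by rewrite intr_eq0.
(* The target is w + t u with t real; rounding t down to j costs at most one vector u. *)
pose t := (x - w1) / u1.
have xt : x - w1 = t * u1 by rewrite divfK.
have yt : y - w2 = t * u2.
  apply: (mulfI BR0); have -> : B%:~R * (t * u2) = - (A%:~R * (t * u1)).
    by rewrite -[RHS]add0r -(mulr0 t) -uline; ring.
  by rewrite -xt; lra.
have /andP[t1 t2] := floor_itv t; set j := Num.floor t in t1 t2.
rewrite intrD in t2.
have small (z : R) : `|z| < e -> `|(j%:~R - t) * z| < e.
  move=> ze; rewrite normrM.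
  have jt : `|j%:~R - t| <= 1 by rewrite ler_norml; apply/andP; split; lra.
  have := normr_ge0 z; nra.
exists (m + j * n%:Z), (p + j * p'), (q + j * q'); rewrite !intrD !intrM; split.
- rewrite (_ : _ - x = (j%:~R - t) * u1); first exact: small.
  by rewrite mulrBl -xt /w1 /u1; ring.
- rewrite (_ : _ - y = (j%:~R - t) * u2); first exact: small.
  by rewrite mulrBl -yt /w2 /u2; ring.
Qed.

(* Two independent short vectors of G span a lattice whose cells are
   smaller than the required precision. *)
Lemma approximable_indep {R : realType} (a b x y : R) :
  (forall A B C : int, A%:~R * a + B%:~R * b = C%:~R -> A = 0 /\ B = 0) ->
  approximable a b x y.
Proof.
move=> indep e e0.
have [|n [p [q [n0 u1e u2e]]]] := dirichlet_pair a b (e / 2); first lra.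
set u1 := n%:R * a - p%:~R in u1e; set u2 := n%:R * b - q%:~R in u2e.
have nR0 : 0 < n%:R :> R by rewrite ltr0n.
have u10 : u1 != 0.
  apply: contraTneq n0 => /eqP; rewrite subr_eq0 => /eqP u1E.
  have [|[->] _ //] := indep n%:Z 0 p.
  by rewrite mul0r addr0.
(* If D were 0, independence would give n p' = n' p, so n v1 = n' u1 and |v1| >= |u1| / n; the
   second bound excludes this. *)
have [|n' [p' [q' [n'0 v1e v2e]]]] :=
  dirichlet_pair a b (Num.min (e / 2) (`|u1| / n%:R)).
  by rewrite lt_min !divr_gt0// normr_gt0.
set v1 := n'%:R * a - p'%:~R in v1e; set v2 := n'%:R * b - q'%:~R in v2e.
move: v1e v2e; rewrite !lt_min => /andP[v1e v1n] /andP[v2e _].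
have n'R1 : 1 <= n'%:R :> R by rewrite ler1n.
pose D := u1 * v2 - u2 * v1.
have D0 : D != 0.
  apply/eqP => D0.
  have [|_ Bp] := indep (n'%:Z * q - n%:Z * q') (n%:Z * p' - n'%:Z * p)
    (q * p' - p * q').
    by apply/eqP; rewrite -subr_eq0 -D0 /D /u1 /u2 /v1 /v2 !intrB !intrM; apply/eqP; ring.
  have Bp' : n%:R * p'%:~R = n'%:R * p%:~R :> R.
    by have /eqP := congr1 (fun z : int => z%:~R : R) Bp;
      rewrite intrB !intrM subr_eq0 => /eqP.
  have vu : n%:R * v1 = n'%:R * u1 by rewrite /v1 /u1 !mulrBr Bp'; ring.
  have := congr1 Num.norm vu; rewrite !normrM !normr_nat => vu'.
  move: v1n; rewrite ltr_pdivlMr// mulrC vu'.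
  have := normr_ge0 u1; nra.
(* Cramer's rule: s and t are the coordinates of (x, y) in the basis u, v. *)
pose s := (x * v2 - y * v1) / D; pose t := (u1 * y - u2 * x) / D.
have sD : s * D = x * v2 - y * v1 by rewrite divfK.
have tD : t * D = u1 * y - u2 * x by rewrite divfK.
have xst : x = s * u1 + t * v1.
  by apply: (mulIf D0); rewrite mulrDl (mulrAC s) (mulrAC t) sD tD /D; ring.
have yst : y = s * u2 + t * v2.
  by apply: (mulIf D0); rewrite mulrDl (mulrAC s) (mulrAC t) sD tD /D; ring.
have /andP[s1 s2] := floor_itv s; set i := Num.floor s in s1 s2.
have /andP[t1 t2] := floor_itv t; set j := Num.floor t in t1 t2.
rewrite intrD in s2; rewrite intrD in t2.
have small (z w : R) : `|z| < e / 2 -> `|w| < e / 2 ->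
    `|(i%:~R - s) * z + (j%:~R - t) * w| < e.
  move=> ze we; rewrite (le_lt_trans (ler_normD _ _))// !normrM.
  have is1 : `|i%:~R - s| <= 1 by rewrite ler_norml; apply/andP; split; lra.
  have jt1 : `|j%:~R - t| <= 1 by rewrite ler_norml; apply/andP; split; lra.
  have := normr_ge0 z; have := normr_ge0 w; nra.
exists (i * n%:Z + j * n'%:Z), (i * p + j * p'), (i * q + j * q').
rewrite !intrD !intrM; split.
- rewrite (_ : _ - x = (i%:~R - s) * u1 + (j%:~R - t) * v1); first exact: small.
  by rewrite xst /u1 /v1; ring.
- rewrite (_ : _ - y = (i%:~R - s) * u2 + (j%:~R - t) * v2); first exact: small.
  by rewrite yst /u2 /v2; ring.
Qed.

(** * Intersecting Beatty sequences *)

Lemma mem_beatty_set {R : realType} (a : R) (m : nat) : 0 < a ->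
  beatty_set a m <->
  exists n : nat, (0 < n)%N /\ m%:R * a <= n%:R < m.+1%:R * a.
Proof.
move=> a0; have eqm (n : nat) :
    (beatty a n == m) = (m%:R * a <= n%:R < m.+1%:R * a).
  by rewrite truncn_eq ?divr_ge0 ?(ltW a0)// ler_pdivlMr// ltr_pdivrMr.
split=> [[n n0 /eqP]|[n [n0 nm]]]; first by rewrite eqm; exists n.
by exists n => //; apply/eqP; rewrite eqm.
Qed.

Lemma beatty_set_posnat {R : realType} (a : R) :
  0 < a -> a < 1 -> beatty_set a `<=` posnat.
Proof.
move=> a0 a1 m /(mem_beatty_set a m a0)[n [n0 /andP[_]]].
have : 1 <= n%:R :> R by rewrite ler1n.
by case: m => // ? ?; lra.
Qed.

(** With [e] the distance from (x, y) to the boundary of the box, the approximation at index m + 1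
    gives 0 < (m + 1) a - p < a, so p lies strictly between m a and (m + 1) a; likewise q for b. An
    index of at least 2 makes m positive, hence p and q too. *)
Lemma beatty_sets_meet {R : realType} (a b x y : R) :
  approximable a b x y -> 0 < x < a -> 0 < y < b ->
  beatty_set a `&` beatty_set b !=set0.
Proof.
move=> ab /andP[x0 xa] /andP[y0 yb].
pose e := Num.min (Num.min x (a - x)) (Num.min y (b - y)).
have [|k [p [q [k2]]]] := approximable_large a b x y e 2 ab.
  by rewrite !lt_min x0 y0 !subr_gt0 xa yb.
rewrite !lt_min => /andP[/andP[px pax] _] /andP[_ /andP[qy qby]].
case: k k2 px pax qy qby => // k k1 px pax qy qby.
have hit (c z : R) (t : int) : 0 < z -> z < c ->
    `|k.+1%:R * c - t%:~R - z| < z -> `|k.+1%:R * c - t%:~R - z| < c - z ->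
    beatty_set c k.
  move=> z0 zc; rewrite !ltr_norml => /andP[h1 h2] /andP[h3 h4].
  have kS : k.+1%:R = k%:R + 1 :> R by rewrite natr1.
  have k0 : 0 < k%:R :> R by rewrite ltr0n.
  have t0 : 0 < t by rewrite -(ltr0z R); nra.
  apply/mem_beatty_set; first lra.
  exists (absz t); split; first by rewrite absz_gt0 gt_eqF.
  have -> : (absz t)%:R = t%:~R :> R by rewrite -[LHS]/((absz t)%:Z%:~R) gtz0_abs.
  by apply/andP; split; nra.
by exists k; split; [apply: (hit a x p)|apply: (hit b y q)].
Qed.

Lemma beatty_disjoint_relation {R : realType} (a b : R) :
  0 < a -> 0 < b -> irrational a -> irrational b ->
  beatty_set a `&` beatty_set b = set0 ->
  exists r s : nat, [/\ (0 < r)%N, (0 < s)%N & r%:R * a + s%:R * b = 1].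
Proof.
move=> a0 b0 irra irrb disj.
have miss x y : 0 < x < a -> 0 < y < b -> ~ approximable a b x y.
  move=> xa yb /beatty_sets_meet/(_ xa yb); rewrite disj.
  by case.
have [[A [B [C [rel AB0]]]]|norel] := pselect (exists A B C : int,
    A%:~R * a + B%:~R * b = C%:~R /\ ~ (A = 0 /\ B = 0)); last first.
  case: (miss (a / 2) (b / 2)); [lra|lra|apply: approximable_indep].
  move=> A B C rel; apply: contrapT => AB0; apply: norel.
  by exists A, B, C.
have B0 : B <> 0.
  move=> B0; apply: AB0; split=> //; move: rel; rewrite B0 mul0r addr0.
  exact: irrational_mul_int.
have A0 : A <> 0.
  move=> A0; apply: B0; move: rel; rewrite A0 mul0r add0r.
  exact: irrational_mul_int.
wlog Apos : A B C rel A0 B0 {AB0} / 0 < A.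
  move=> W; have [|An] := ltP 0 A; first exact: (W A B C).
  apply: (W (- A) (- B) (- C)); rewrite ?intrN; [lra|lia|lia|lia].
have ApR : 0 < A%:~R :> R by rewrite ltr0z.
have [Bneg|] := ltP B 0.
  have BnR : B%:~R < 0 :> R by rewrite ltrz0.
  (* The point (- B d, A d) lies on the line through 0, and d is small enough for both coordinates
     to be at most min(a, b) / 2. *)
  pose N : R := A%:~R - B%:~R.
  have N0 : 0 < N by rewrite /N; lra.
  pose d := Num.min a b / (2 * N).
  have dN : d * (2 * N) = Num.min a b by rewrite divfK// mulf_neq0 ?gt_eqF.
  have d0 : 0 < d by rewrite divr_gt0 ?mulr_gt0 ?lt_min ?a0 ?b0.
  have : Num.min a b <= a by rewrite ge_min lexx.
  have : Num.min a b <= b by rewrite ge_min lexx orbT.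
  rewrite -dN /N => mb ma.
  case: (miss (- B%:~R * d) (A%:~R * d)); [apply/andP; split; nra..|].
  apply: (@approximable_line _ _ _ _ _ A B C 0 0 0) => //; first exact/eqP.
  by rewrite /=; ring.
move=> B_ge0; have Bpos : 0 < B by lia.
have BpR : 0 < B%:~R :> R by rewrite ltr0z.
have Cpos : 0 < C by rewrite -(ltr0z R) -rel; nra.
(* Dividing by g leaves A' a + B' b = C'. If C' = 1 this is the desired relation; otherwise (a / C',
   b / C') is a point of the box on the line A x + B y = g. *)
pose g := gcdz (gcdz A B) C.
have gAB : (g %| gcdz A B)%Z by exact: dvdz_gcdl.
have [A' AE] := dvdzP (dvdz_trans gAB (dvdz_gcdl A B)).
have [B' BE] := dvdzP (dvdz_trans gAB (dvdz_gcdr A B)).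
have [C' CE] := dvdzP (dvdz_gcdr (gcdz A B) C); rewrite -/g in CE.
have g0 : 0 < g.
  rewrite lt_neqAle eq_sym gcdz_eq0 gcdz_eq0; apply/andP; split; last by [].
  by apply/negP => /andP[/andP[/eqP]].
have gR : 0 < g%:~R :> R by rewrite ltr0z.
have gR0 : g%:~R != 0 :> R by rewrite gt_eqF.
have A'0 : 0 < A' by nia.
have B'0 : 0 < B' by nia.
have C'0 : 0 < C' by nia.
have rel' : A'%:~R * a + B'%:~R * b = C'%:~R.
  apply: (mulIf gR0); rewrite -intrM -CE -rel AE BE !intrM; ring.
have [C1|C1] := eqVneq C' 1.
  exists (absz A'), (absz B'); split; [lia|lia|].
  rewrite -[X in X * a]/((absz A')%:Z%:~R) -[X in X * b]/((absz B')%:Z%:~R).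
  by rewrite !gtz0_abs// rel' C1.
have CR0 : 0 < C'%:~R :> R by rewrite ltr0z.
have CR1 : 1 < C'%:~R :> R by rewrite -[1]/(1%:~R) ltr_int; lia.
have inbox (z : R) : 0 < z -> 0 < z / C'%:~R < z.
  by move=> z0; rewrite divr_gt0//= ltr_pdivrMr// ltr_pMr.
case: (miss (a / C'%:~R) (b / C'%:~R)); [exact: inbox..|].
(* Two Bezout identities give g = u (u' A + v' B) + v C, so the point (v a + u u', v b + u v') of G
   lies on that line. *)
have [u [v uv]] := Bezoutz (gcdz A B) C.
have [u' [v' uv']] := Bezoutz A B.
apply: (@approximable_line _ _ _ _ _ A B C v (- (u * u')) (- (u * v'))) => //.
  exact/eqP.
have gE := congr1 (fun z : int => z%:~R : R) uv.
rewrite /= -/g -uv' !(intrD, intrM) in gE.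
have CC : C'%:~R * g%:~R = C%:~R :> R by rewrite CE intrM.
have gCC : A%:~R * (a / C'%:~R) + B%:~R * (b / C'%:~R) = g%:~R.
  by rewrite !mulrA -mulrDl rel -CC mulrC mulKf// gt_eqF.
rewrite !intrN !intrM !mulrBr (addrACA _ _ _ (- _)) gCC -gE -rel.
by ring.
Qed.

(** * Counting *)

Lemma irrational_mul_nat {R : realType} (a : R) (m n : nat) :
  irrational a -> (0 < m)%N -> m%:R * a != n%:R.
Proof.
move=> irra; apply: contraTneq => man.
by have [->] := irrational_mul_int a m%:Z n%:Z irra man.
Qed.

(** A common element m, hit by p and q, would put the integer r p + s q strictly between m (r a + s
    b) = m and m + 1. The lower inequality is strict because a is irrational and m > 0. *)
Lemma beatty_disjoint {R : realType} (a b : R) (r s : nat) :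
  0 < a -> 0 < b -> irrational a -> (0 < r)%N ->
  r%:R * a + s%:R * b = 1 -> beatty_set a `&` beatty_set b = set0.
Proof.
move=> a0 b0 irra r0 rel; apply/seteqP; split=> // m [].
move=> /(mem_beatty_set _ _ a0)[p [p0 /andP[p1 p2]]].
move=> /(mem_beatty_set _ _ b0)[q [q0 /andP[q1 q2]]].
have rR : 0 < r%:R :> R by rewrite ltr0n.
have sR : 0 <= s%:R :> R by rewrite ler0n.
have mS : m.+1%:R = m%:R + 1 :> R by rewrite natr1.
have m0 : (0 < m)%N.
  rewrite lt0n; apply: contraTneq p0 => m0; rewrite -leqNgt.
  rewrite mS m0 add0r mul1r in p2 q2; rewrite -ltnS -(ltr_nat R).
  have r1 : 1 <= r%:R :> R by rewrite ler1n.
  have : a <= 1 by nra.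
  by lra.
have p3 : m%:R * a < p%:R by rewrite lt_neqAle irrational_mul_nat.
rewrite mS in p2 q2.
have rel_m (c : R) : c = r%:R * (c * a) + s%:R * (c * b).
  by rewrite -[LHS]mulr1 -[in LHS]rel; ring.
have lo : m%:R < (r * p + s * q)%:R :> R.
  rewrite natrD !natrM [X in X < _]rel_m.
  by apply: ltr_leD; [rewrite ltr_pM2l|rewrite ler_wpM2l].
have hi : (r * p + s * q)%:R < m.+1%:R :> R.
  rewrite mS natrD !natrM [X in _ < X]rel_m.
  by apply: ltr_leD; [rewrite ltr_pM2l|rewrite ler_wpM2l// ltW].
by move: lo hi; rewrite !ltr_nat => lo; rewrite ltnS leqNgt lo.
Qed.

Definition count_upto (S : set nat) (m : nat) : nat :=
  \sum_(1 <= i < m.+1) `[< S i >].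

Lemma count_upto0 S : count_upto S 0 = 0%N.
Proof. by rewrite /count_upto big_geq. Qed.

Lemma count_uptoS S m : count_upto S m.+1 = (count_upto S m + `[< S m.+1 >])%N.
Proof. by rewrite /count_upto big_nat_recr. Qed.

Lemma leq_count_upto S : {homo count_upto S : m n / (m <= n)%N}.
Proof.
by apply: homo_leq => [//||m]; [exact: leq_trans|rewrite count_uptoS leq_addr].
Qed.

Lemma count_upto_gap S m n : (m <= n)%N ->
  (forall i, (m < i <= n)%N -> ~ S i) -> count_upto S n = count_upto S m.
Proof.
elim: n => [|n IHn]; first by rewrite leqn0 => /eqP ->.
rewrite leq_eqVlt => /predU1P[-> //|]; rewrite ltnS => mn gap.
rewrite count_uptoS IHn// => [|i /andP[mi im]]; last first.
  by apply: gap; rewrite mi leqW.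
rewrite asboolF ?addn0//; apply: gap.
by rewrite ltnS mn leqnn.
Qed.

Lemma count_upto_enumerates S ct n : S `<=` posnat ->
  enumerates S ct -> (0 < n)%N -> count_upto S (ct n) = n.
Proof.
move=> Spos [incr valS]; case: n => // n _.
have ctS k : S (ct k.+1) by rewrite -valS; exists k.+1.
have lt_idx j k : (0 < j)%N -> (0 < k)%N -> (ct j < ct k)%N -> (j < k)%N.
  move=> j0 k0; rewrite !ltnNge; apply: contra => kj.
  move: kj; rewrite leq_eqVlt => /predU1P[-> //|kj].
  by apply: ltnW; exact: incr.
(* One induction step, stated so as to cover also the start m = k = 0: the last hypothesis excludes
   elements of S strictly between m and [ct k.+1]. *)
have step m k : count_upto S m = k -> (m < ct k.+1)%N ->
    (forall i, (0 < i)%N -> (m < ct i)%N -> (k < i)%N) ->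
    count_upto S (ct k.+1) = k.+1.
  move=> cm; have := ctS k; case: (ct k.+1) (lt_idx^~ k.+1) => // v lt_v Sv.
  rewrite ltnS => mv next.
  rewrite count_uptoS asboolT// addn1 (count_upto_gap S m v mv) ?cm//.
  move=> i /andP[mi iv]; rewrite -valS => -[j j0 ij].
  rewrite -ij in mi iv.
  have := next j j0 mi; have := lt_v j j0 isT; rewrite ltnS iv => /(_ isT).
  by rewrite ltnS leqNgt => /negbTE ->.
elim: n => [|n IHn].
  by apply: (step 0%N); rewrite ?count_upto0//; exact: (Spos _ (ctS 0%N)).
apply: (step (ct n.+1)) => //; first exact: incr.
by move=> i i0; exact: lt_idx.
Qed.

(** The nth element is the least m at which the count reaches n: the count jumps there, so m lies in
    S and the count is exactly n. *)
Lemma exists_enumerates S : S `<=` posnat ->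
  (forall n, exists m, (n <= count_upto S m)%N) -> exists ct, enumerates S ct.
Proof.
move=> Spos unbd; pose ct n := ex_minn (unbd n).
have ctP n : (0 < n)%N -> S (ct n) /\ count_upto S (ct n) = n.
  rewrite /ct; case: ex_minnP => -[|v]; first by rewrite count_upto0; case: n.
  rewrite count_uptoS => nv minv n0.
  have : (count_upto S v < n)%N.
    by rewrite ltnNge; apply/negP => /minv; rewrite ltnn.
  by case: asboolP nv => [Sv|_]; [split=> //; lia|lia].
exists ct; split=> [m n m0 n0 mn|].
  have [_ cm] := ctP m m0; have [_ cn] := ctP n n0.
  rewrite ltnNge; apply/negP => /(leq_count_upto S).
  by rewrite cm cn leqNgt mn.
apply/seteqP; split=> [_ [n n0 <-]|m Sm]; first by have [] := ctP n n0.
have := Spos _ Sm; case: m Sm => // m Sm _.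
have cm : count_upto S m.+1 = (count_upto S m).+1.
  by rewrite count_uptoS asboolT// addn1.
exists (count_upto S m.+1); first by rewrite cm.
rewrite /ct; case: ex_minnP => v cv minv.
apply/eqP; rewrite eqn_leq minv//= ltnNge; apply/negP => /(leq_count_upto S).
by lia.
Qed.

(** Induction on m: floor((m + 2) a) exceeds floor((m + 1) a) exactly when an integer lies between
    (m + 1) a and (m + 2) a, that is, when m + 1 is in the Beatty set. Irrationality excludes
    equality at the endpoints. *)
Lemma count_upto_beatty {R : realType} (a : R) m :
  0 < a -> a < 1 -> irrational a ->
  count_upto (beatty_set a) m = Num.truncn (m.+1%:R * a).
Proof.
move=> a0 a1 irra; elim: m => [|m IHm].
  by rewrite count_upto0 mul1r; apply/esym/eqP; rewrite truncn_eq ?ltW.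
rewrite count_uptoS IHm; apply/esym/eqP.
have pos k : 0 <= k%:R * a by rewrite mulr_ge0// ltW.
rewrite truncn_eq//; have /andP[] := truncn_itv (pos m.+1).
set t := Num.truncn _; rewrite -!natr1 => t1 t2.
case: asboolP => [/(mem_beatty_set _ _ a0)[n [n0]]|hit] /=.
  rewrite -!natr1 => /andP[n1 n2].
  have n3 : (m%:R + 1) * a < n%:R.
    by rewrite lt_neqAle n1 andbT natr1 irrational_mul_nat.
  have tn : (t < n)%N by rewrite -(ltr_nat R); lra.
  have nt : (n < t.+2)%N by rewrite -(ltr_nat R) -!natr1; nra.
  have -> : (t + 1)%N = n by lia.
  by apply/andP; split; nra.
rewrite addn0; apply/andP; split; first nra.
have : ((m%:R + 1 + 1) * a != t%:R + 1).
  by rewrite !natr1 irrational_mul_nat.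
rewrite neq_lt natr1 => /orP[//|gt_t]; case: hit.
apply/mem_beatty_set => //; exists t.+1; split=> //.
by rewrite -!natr1 natr1; apply/andP; split; lra.
Qed.

Lemma count_upto_rest (A B : set nat) m : A `&` B = set0 ->
  (count_upto (posnat `\` (A `|` B)) m + count_upto A m + count_upto B m)%N = m.
Proof.
move=> /seteqP[AB _]; elim: m => [|m IHm]; first by rewrite !count_upto0.
rewrite !count_uptoS -[in RHS]IHm.
case: (asboolP ((_ `\` _) m.+1)) => [[_ /not_orP[nA nB]]|nrest].
  by rewrite !asboolF//; lia.
have : A m.+1 \/ B m.+1.
  by apply: contrapT => nAB; apply: nrest; split.
case: (asboolP (A _)) => [Am|nA]; case: (asboolP (B _)) => [Bm|nB] //=; try lia.
- by have := AB m.+1 (conj Am Bm).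
- by case.
Qed.

(** * The maximal deviation *)

Lemma floor_deviation_lt_half {R : realType} (a : R) :
  0 < a -> a < 1 / 2 -> Num.floor ((2 - a) / (1 - a)) = 2.
Proof.
move=> a0 a2; have a1 : 0 < 1 - a by lra.
apply/eqP; rewrite floor_eq ler_pdivlMr// ltr_pdivrMr// !intrD.
by apply/andP; split; lra.
Qed.

Lemma floor_deviation_ge2 {R : realType} (a : R) :
  0 < a -> a < 1 -> 2 <= Num.floor ((2 - a) / (1 - a)).
Proof.
move=> a0 a1; have a1' : 0 < 1 - a by lra.
by rewrite floor_ge_int ler_pdivlMr//; lra.
Qed.

Lemma max_deviationC {R : realType} (a b : R) :
  max_deviation a b = max_deviation b a.
Proof. by rewrite /max_deviation maxC. Qed.

(** Here rho = 1 / r is the infimum of x + y under the constraint, approached as y tends to 0. The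
    first two inequalities say that [max_deviation a b] is the ceiling of (1 - rho) / (1 - a -
    b). *)
Lemma max_deviation_spec_lt {R : realType} (a b : R) (r s : nat) :
  0 < a -> 0 < b -> a + b < 1 -> irrational b ->
  (0 < s < r)%N -> r%:R * a + s%:R * b = 1 -> exists rho,
  [/\ (max_deviation a b - 1)%:~R * (1 - a - b) < 1 - rho,
      1 - rho <= (max_deviation a b)%:~R * (1 - a - b),
      forall x y, 0 < x -> 0 < y -> 1 <= r%:R * x + s%:R * y -> rho < x + y
    & forall e, 0 < e -> exists x y,
        [/\ 0 < x < 1 - a, 0 < y < 1 - b,
            r%:R * x + s%:R * y = 1 & x + y < rho + e]].
Proof.
move=> a0 b0 ab1 irrb /andP[s0 sr] rel.
set M := max_deviation a b.
have s1 : 1 <= s%:R :> R by rewrite ler1n.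
have rs : s%:R + 1 <= r%:R :> R by rewrite natr1 ler_nat.
have rR0 : 0 < r%:R :> R by lra.
exists r%:R^-1; set rho := r%:R^-1.
have rho_r : rho * r%:R = 1 by rewrite mulVf ?gt_eqF.
have rho0 : 0 < rho by rewrite invr_gt0.
have a_rho : a < rho by nra.
have rho2 : rho <= 1 / 2 by nra.
have Mbounds : (M - 1)%:~R * (1 - a - b) < 1 - rho <= M%:~R * (1 - a - b).
  (* For s >= 2 one has a + b < 1 / s <= 1 / 2, so both floors are 2. For s = 1 one has 1 - b = r a,
     and after division by r - 1 the claim becomes (M - 1) a < rho <= M a. *)
  rewrite intrB; have [s_gt1|s_le1] := ltnP 1 s.
    have s2 : 2 <= s%:R :> R by rewrite ler_nat.
    have sab : s%:R * (a + b) < 1 by rewrite -[X in _ < X]rel; nra.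
    have rab : 1 < r%:R * (a + b) by rewrite -[X in X < _]rel; nra.
    have M2 : M = 2.
      by rewrite /M /max_deviation !floor_deviation_lt_half//; nra.
    by rewrite M2; apply/andP; split; nra.
  have s_eq1 : s = 1%N by apply/eqP; rewrite eqn_leq s_le1.
  have ra : 1 - b = r%:R * a by rewrite -[in LHS]rel s_eq1; ring.
  have b1 : 0 < 1 - b by lra.
  have MF : M = Num.floor ((2 - b) / (1 - b)).
    rewrite /M /max_deviation floor_deviation_lt_half//; last lra.
    by rewrite max_r// floor_deviation_ge2//; lra.
  have M2 : 2 <= M by rewrite MF floor_deviation_ge2//; lra.
  have := floor_itv ((2 - b) / (1 - b)).
  rewrite -MF ler_pdivlMr// ltr_pdivrMr// intrD => /andP[M_le M_gt].
  (* Equality would give (M - 1) b = M - 2, so M = 1 by irrationality of b, against M >= 2. *)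
  have M_neq : (M%:~R - 1) * (1 - b) != 1.
    apply/eqP => M_eq; have /subr0_eq M1 : M - 1 = 0; last by rewrite M1 in M2.
    apply: (irrational_mul_int b (M - 1) (M - 2) irrb).
    by rewrite !intrB -[1%:~R]/(1 : R) -[2%:~R]/(2 : R); lra.
  have M_lt : (M%:~R - 1) * (1 - b) < 1.
    by rewrite lt_neqAle M_neq; lra.
  have Ma_lt : (M%:~R - 1) * a < rho.
    by rewrite -(ltr_pM2r rR0) rho_r -mulrA (mulrC a) -ra.
  have Ma_gt : rho < M%:~R * a.
    by rewrite -(ltr_pM2r rR0) rho_r -mulrA (mulrC a) -ra; lra.
  have -> : 1 - a - b = (r%:R - 1) * a by lra.
  have -> : 1 - rho = (r%:R - 1) * rho by lra.
  rewrite ![_ * ((r%:R - 1) * a)]mulrCA ltr_pM2l; last lra.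
  by rewrite ler_pM2l ?Ma_lt ?ltW//; lra.
case/andP: Mbounds => M_lt M_ge; split=> // [x y x0 y0 xy|e e0].
  by rewrite -(ltr_pM2r rR0) rho_r; nra.
(* A small y with x solved from the line: e controls x + y, 1 - b bounds y, and 1 / s keeps x
   positive. *)
pose y := Num.min (Num.min e (1 - b)) s%:R^-1 / 2.
have y2 : y * 2 = Num.min (Num.min e (1 - b)) s%:R^-1 by rewrite divfK.
have sR0 : 0 < s%:R :> R by lra.
have y0 : 0 < y by rewrite divr_gt0// !lt_min e0 subr_gt0 invr_gt0 sR0 andbT; lra.
have : y * 2 <= y * 2 by [].
rewrite {2}y2 !le_min => /andP[/andP[ye yb]].
rewrite -(ler_pM2r sR0) mulVf ?gt_eqF// => ys.
exists ((1 - s%:R * y) * rho), y; split.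
- by apply/andP; split; nra.
- by apply/andP; split; lra.
- by rewrite mulrCA (mulrC _ rho) rho_r; lra.
- nra.
Qed.

(** The case r < s follows by exchanging a and b; r = s would give r (a + b) = 1, against the
    irrationality of a + b. *)
Lemma max_deviation_spec {R : realType} (a b : R) (r s : nat) :
  0 < a -> 0 < b -> a + b < 1 -> irrational a -> irrational b ->
  irrational (a + b) -> (0 < r)%N -> (0 < s)%N ->
  r%:R * a + s%:R * b = 1 -> exists rho,
  [/\ (max_deviation a b - 1)%:~R * (1 - a - b) < 1 - rho,
      1 - rho <= (max_deviation a b)%:~R * (1 - a - b),
      forall x y, 0 < x -> 0 < y -> 1 <= r%:R * x + s%:R * y -> rho < x + y
    & forall e, 0 < e -> exists x y,
        [/\ 0 < x < 1 - a, 0 < y < 1 - b,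
            r%:R * x + s%:R * y = 1 & x + y < rho + e]].
Proof.
move=> a0 b0 ab1 irra irrb irrab r0 s0 rel.
have [sr|rs|rs] := ltngtP s r.
- by apply: max_deviation_spec_lt; rewrite ?s0.
- have rel' : s%:R * b + r%:R * a = 1 by rewrite addrC.
  have [||rho [M1 M2 lo hi]] :=
    max_deviation_spec_lt b a s r b0 a0 _ irra _ rel'; [lra|by rewrite r0|].
  rewrite -max_deviationC addrAC in M1 M2.
  exists rho; split=> // [x y x0 y0 xy|e /hi[y [x [y1 x1 xy xye]]]].
    by rewrite addrC; apply: lo; rewrite // addrC.
  by exists x, y; split; rewrite // addrC.
- have /eqP[] := irrational_mul_nat (a + b) r 1 irrab r0.
  by rewrite mulrDr -[in X in _ + X]rs.
Qed.

Lemma unbounded_infinite_set (A : set nat) :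
  (forall N, exists2 n, (N <= n)%N & A n) -> infinite_set A.
Proof.
move=> unbd /finite_seqP[s sA].
have [n] := unbd (\max_(i <- s) i).+1.
rewrite sA /= => lt_n ns; move: lt_n; rewrite ltnNge.
by rewrite (@leq_bigmax_seq _ s predT (fun i => i)).
Qed.

(** * Fractional parts and the deviation along the complement *)

(** The middle term is 1 - {k a} for k = m + 1. Since no positive integer lies in [m a, k a),
    floor(k a) < m a, that is, {k a} > a. *)
Lemma beatty_gap {R : realType} (a : R) (m : nat) :
  0 < a -> a < 1 -> irrational a -> (0 < m)%N -> ~ beatty_set a m ->
  0 < (Num.truncn (m.+1%:R * a)).+1%:R - m.+1%:R * a < 1 - a.
Proof.
move=> a0 a1 irra m0 nBm.
have /andP[] := truncn_itv (mulr_ge0 (ler0n R m.+1) (ltW a0)).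
have : (Num.truncn (m.+1%:R * a))%:R < m%:R * a; last first.
  by rewrite -!natr1 => t_m _ t_gt; apply/andP; split; lra.
set t := Num.truncn _; have [->|t0] := posnP t; first by rewrite mulr_gt0 ?ltr0n.
rewrite ltNge; apply/negP => mt; apply: nBm; apply/mem_beatty_set => //.
exists t; split=> //; rewrite mt lt_neqAle eq_sym irrational_mul_nat//=.
by rewrite truncn_le mulr_ge0 ?(ltW a0).
Qed.

Lemma beatty_gapP {R : realType} (a : R) (m p : nat) : 0 < a ->
  0 < p.+1%:R - m.+1%:R * a < 1 - a ->
  ~ beatty_set a m /\ Num.truncn (m.+1%:R * a) = p.
Proof.
rewrite -!natr1 => a0 /andP[p_gt p_lt]; split.
  move=> /(mem_beatty_set _ _ a0)[n [n0]]; rewrite -natr1 => /andP[mn nm].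
  have : (n < p.+1)%N by rewrite -(ltr_nat R) -natr1; lra.
  by rewrite ltnS -(ler_nat R); lra.
apply/eqP; rewrite truncn_eq -?natr1; first by apply/andP; split; lra.
by rewrite mulr_ge0 ?(ltW a0)// natr1.
Qed.

(** With k = m + 1, x = A + 1 - k a and y = B + 1 - k b, the count reads n = k g + 1 - x - y.
    Subtracting m g from c g <= n < (c + 1) g, where c = [beatty g n], gives both bounds. *)
Lemma deviation_sandwich {R : realType} (a b g : R) (m n A B : nat) :
  0 < g -> a + b + g = 1 -> (n + A + B)%N = m ->
  ((beatty g n)%:R - m%:R) * g
    <= g + 1 - (A.+1%:R - m.+1%:R * a) - (B.+1%:R - m.+1%:R * b)
    < ((beatty g n)%:R - m%:R + 1) * g.
Proof.
move=> g0 abg mE.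
have /andP[] := truncn_itv (divr_ge0 (ler0n R n) (ltW g0)).
rewrite -/(beatty g n) ler_pdivlMr// ltr_pdivrMr// -!natr1.
have -> : g = 1 - a - b by lra.
by rewrite -mE !natrD => lo hi; apply/andP; split; nra.
Qed.

Lemma count_rest {R : realType} (a b : R) (m : nat) :
  0 < a -> a < 1 -> irrational a -> 0 < b -> b < 1 -> irrational b ->
  beatty_set a `&` beatty_set b = set0 ->
  (count_upto (posnat `\` (beatty_set a `|` beatty_set b)) m
     + Num.truncn (m.+1%:R * a) + Num.truncn (m.+1%:R * b))%N = m.
Proof.
move=> a0 a1 irra b0 b1 irrb disj.
by rewrite -!count_upto_beatty// count_upto_rest.
Qed.

Lemma exists_enumerates_rest {R : realType} (a b : R) :
  0 < a -> irrational a -> 0 < b -> irrational b -> a + b < 1 ->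
  beatty_set a `&` beatty_set b = set0 ->
  exists ct, enumerates (posnat `\` (beatty_set a `|` beatty_set b)) ct.
Proof.
move=> a0 irra b0 irrb ab1 disj; apply: exists_enumerates => [m []//|n].
have g0 : 0 < 1 - a - b by lra.
(* The count up to m is at least m - (m + 1)(a + b) = (m + 1)(1 - a - b) - 1, which exceeds n for
   this m. *)
pose m := (Num.truncn (n.+1%:R / (1 - a - b))).+1; exists m.
have : n.+1%:R / (1 - a - b) < m%:R by exact: truncnS_gt.
rewrite ltr_pdivrMr// -natr1 => nm.
have := @count_rest R a b m a0 _ irra b0 _ irrb disj.
have le_ma (c : R) : 0 < c -> (Num.truncn (m.+1%:R * c))%:R <= m.+1%:R * c.
  by move=> c0; rewrite truncn_le mulr_ge0// ltW.
have := le_ma a a0; have := le_ma b b0.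
set S := count_upto _ _; set A := Num.truncn (_ * a).
set B := Num.truncn (_ * b) => hB hA.
move=> /(_ ltac:(lra) ltac:(lra)) mE; rewrite -(ler_nat R).
have : (S + A + B)%:R = m%:R :> R by rewrite mE.
move: hA hB; rewrite !natrD -natr1; nra.
Qed.

(** The bounds x < 1 - a and y < 1 - b give g + 1 - x - y > 0, so the deviation is nonnegative; x +
    y > rho gives g + 1 - x - y < (M + 1) g, so it is at most M. *)
Lemma deviation_le_max {R : realType} (a b g : R) (r s : nat)
    (ct : nat -> nat) (n : nat) :
  0 < a -> 0 < b -> 0 < g -> irrational a -> irrational b ->
  irrational (a + b) -> a + b + g = 1 -> (0 < r)%N -> (0 < s)%N ->
  r%:R * a + s%:R * b = 1 ->
  enumerates (posnat `\` (beatty_set a `|` beatty_set b)) ct -> (0 < n)%N ->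
  0 <= (beatty g n)%:Z - (ct n)%:Z <= max_deviation a b.
Proof.
move=> a0 b0 g0 irra irrb irrab abg r0 s0 rel enum n0.
have disj := beatty_disjoint a b r s a0 b0 irra r0 rel.
have a1 : a < 1 by lra.
have b1 : b < 1 by lra.
have ab1 : a + b < 1 by lra.
have [m0 /not_orP[nBa nBb]] : (posnat `\` (beatty_set a `|` beatty_set b)) (ct n).
  by have [_ <-] := enum; exists n.
have := @count_rest R a b (ct n) a0 a1 irra b0 b1 irrb disj.
rewrite count_upto_enumerates// => mE.
have /andP[lo hi] := deviation_sandwich a b g _ _ _ _ g0 abg mE.
have := beatty_gap a (ct n) a0 a1 irra m0 nBa.
have := beatty_gap b (ct n) b0 b1 irrb m0 nBb.
set c := beatty g n in lo hi *; set m := ct n in lo hi mE *.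
set A := Num.truncn (_ * a) in lo hi mE *; set B := Num.truncn (_ * b) in lo hi mE *.
move=> /andP[y0 y1] /andP[x0 x1].
have [rho [_ M_ge rho_lt _]] :=
  max_deviation_spec a b r s a0 b0 ab1 irra irrb irrab r0 s0 rel.
have gE : 1 - a - b = g by lra.
rewrite gE in M_ge.
(* By r a + s b = 1, r x + s y is an integer; being positive, it is at least 1. *)
have lineE : r%:R * (A.+1%:R - m.+1%:R * a) + s%:R * (B.+1%:R - m.+1%:R * b) =
    (r%:Z * A.+1%:Z + s%:Z * B.+1%:Z - m.+1%:Z)%:~R :> R.
  rewrite intrB intrD !intrM -![(Posz _)%:~R]/(_%:R).
  have mE' : m.+1%:R = m.+1%:R * (r%:R * a + s%:R * b) by rewrite rel mulr1.
  by rewrite [in RHS]mE'; ring.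
have xy_ge1 : 1 <= r%:R * (A.+1%:R - m.+1%:R * a) +
    s%:R * (B.+1%:R - m.+1%:R * b).
  have : 0 < r%:R * (A.+1%:R - m.+1%:R * a) + s%:R * (B.+1%:R - m.+1%:R * b).
    by rewrite addr_gt0// mulr_gt0// ltr0n.
  by rewrite lineE ltr0z -[X in X <= _]/(1%:~R) ler_int gtz0_ge1.
have xy_gt := rho_lt _ _ x0 y0 xy_ge1.
rewrite -[c%:R]/(c%:Z%:~R) -[m%:R]/(m%:Z%:~R) -intrB in lo hi.
set d := c%:Z - m%:Z in lo hi *.
have d_ge : 0 < (d%:~R + 1) * g by lra.
have d_le : d%:~R * g < (max_deviation a b + 1)%:~R * g by rewrite intrD; lra.
rewrite pmulr_lgt0// -[1]/(1%:~R) -intrD ltr0z ltzD1 in d_ge.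
by rewrite ltr_pM2r// ltr_int ltzD1 in d_le; rewrite d_ge.
Qed.

Lemma deviation_max_attained {R : realType} (a b g : R) (r s : nat)
    (ct : nat -> nat) (N : nat) :
  0 < a -> 0 < b -> 0 < g -> irrational a -> irrational b ->
  irrational (a + b) -> a + b + g = 1 -> (0 < r)%N -> (0 < s)%N ->
  r%:R * a + s%:R * b = 1 ->
  enumerates (posnat `\` (beatty_set a `|` beatty_set b)) ct ->
  exists2 n, (N < n)%N & (beatty g n)%:Z - (ct n)%:Z = max_deviation a b.
Proof.
move=> a0 b0 g0 irra irrb irrab abg r0 s0 rel enum.
have disj := beatty_disjoint a b r s a0 b0 irra r0 rel.
have a1 : a < 1 by lra.
have b1 : b < 1 by lra.
have ab1 : a + b < 1 by lra.
have [rho [M_lt _ _ approach]] :=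
  max_deviation_spec a b r s a0 b0 ab1 irra irrb irrab r0 s0 rel.
have gE : 1 - a - b = g by lra.
rewrite gE in M_lt.
(* This makes rho + 2 e = 1 - (M - 1) g: one e is spent on x + y, the other on the two approximation
   errors. *)
pose e := (1 - rho - (max_deviation a b - 1)%:~R * g) / 2.
have e0 : 0 < e by rewrite /e; lra.
have [x [y [/andP[x0 x1] /andP[y0 y1] xy_line xy_lt]]] := approach e e0.
pose d := Num.min (Num.min x (1 - a - x))
            (Num.min (Num.min y (1 - b - y)) (e / 2)).
have d0 : 0 < d by rewrite !lt_min; apply/and3P; split; lra.
have line : approximable a b (- x) (- y).
  (* The line r X + s Y = -1 through (- x, - y) contains the point (- a, - b) of G. *)
  apply: (@approximable_line _ _ _ _ _ r%:Z s%:Z 1 (-1) 0 0) => //.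
  - by rewrite -lt0n.
  - rewrite intrN -[1%:~R]/(1 : R) -[0%:~R]/(0 : R) -[r%:~R]/(r%:R) -[s%:~R]/(s%:R).
    by lra.
(* An index k = m + 1 of at least [(ct N).+2] yields m > [ct N], hence a position n > N. *)
have [k [p [q [kK xd yd]]]] := approximable_large a b (- x) (- y) d (ct N).+2 line d0.
case: k kK xd yd => // m mK.
have ctm : (ct N < m)%N := mK.
have m0 : (0 < m)%N := leq_ltn_trans (leq0n _) ctm.
rewrite !lt_min !ltr_norml.
move=> /andP[/andP[/andP[hx1 hx2] /andP[hx3 hx4]] /andP[_ /andP[hx5 hx6]]].
move=> /andP[_ /andP[/andP[/andP[hy1 hy2] /andP[hy3 hy4]] /andP[hy5 hy6]]].
have natp (c z : R) (t : int) : 0 < c -> 0 < z ->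
    m.+1%:R * c - t%:~R - - z < z -> exists t' : nat, t = t'.+1%:Z.
  move=> c0 z0 hz; have : 0 < t.
    rewrite -(ltr0z R); have : 0 < m.+1%:R * c by rewrite mulr_gt0// ltr0n.
    lra.
  by case: t hz => // -[|t'] // _ _; exists t'.
have [A pE] := natp _ _ _ a0 x0 hx2; have [B qE] := natp _ _ _ b0 y0 hy2.
subst p q; rewrite -!pmulrn in hx1 hx2 hx3 hx4 hx5 hx6 hy1 hy2 hy3 hy4 hy5 hy6.
have [|nBa AE] := beatty_gapP a m A a0; first by apply/andP; split; lra.
have [|nBb BE] := beatty_gapP b m B b0; first by apply/andP; split; lra.
have [n n0 nm] : values ct m.
  by have [_ ->] := enum; split=> // -[].
exists n.
  rewrite ltnNge; apply/negP; rewrite leq_eqVlt => /predU1P[nN|nN].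
    by rewrite -nm nN ltnn in ctm.
  have [incr _] := enum.
  have := incr n N n0 (leq_trans n0 (ltnW nN)) nN.
  by rewrite nm => /(ltn_trans ctm); rewrite ltnn.
have := @count_rest R a b m a0 a1 irra b0 b1 irrb disj.
rewrite AE BE -{1}nm count_upto_enumerates// => mE.
have /andP[_ hi] := deviation_sandwich a b g _ _ _ _ g0 abg mE.
have /andP[_ dM] := deviation_le_max a b g r s ct n a0 b0 g0 irra irrb irrab
  abg r0 s0 rel enum n0.
apply/eqP; rewrite eq_le dM/= nm.
set c := beatty g n in hi *.
rewrite -[c%:R]/(c%:Z%:~R) -[m%:R]/(m%:Z%:~R) -intrB in hi.
rewrite -ltzD1 -(ltr_int R) [X in _ < X]intrD -[1%:~R]/(1 : R).
rewrite -(ltr_pM2r g0); apply: le_lt_trans hi.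
have eE : e * 2 = 1 - rho - (max_deviation a b - 1)%:~R * g by rewrite divfK.
rewrite intrB mulrBl -[1%:~R]/(1 : R) mul1r in eE; lra.
Qed.

(** * Partitions, distance and the final assembly *)

Lemma is_partition_rest (A B : set nat) :
  A `<=` posnat -> B `<=` posnat -> A `&` B = set0 ->
  is_partition (tnth [tuple A; B; posnat `\` (A `|` B)]).
Proof.
move=> Apos Bpos /seteqP[AB _].
set F := tnth _.
pose i0 := @Ordinal 3 0 isT; pose i1 := @Ordinal 3 1 isT.
pose i2 := @Ordinal 3 2 isT.
have F0 : F i0 = A by [].
have F1 : F i1 = B by [].
have F2 : F i2 = posnat `\` (A `|` B) by [].
have ord3 (P : 'I_3 -> Prop) : P i0 -> P i1 -> P i2 -> forall i, P i.
  move=> P0 P1 P2 [[|[|[|//]]] i3].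
  - by rewrite (_ : Ordinal i3 = i0) //; exact: val_inj.
  - by rewrite (_ : Ordinal i3 = i1) //; exact: val_inj.
  - by rewrite (_ : Ordinal i3 = i2) //; exact: val_inj.
split; first by apply: ord3; rewrite ?F0 ?F1 ?F2 // => m [].
move=> m m0; have [Am|nA] := pselect (A m).
  exists i0; split; first by rewrite F0.
  apply: ord3; rewrite ?F0 ?F1 ?F2 //.
  - by move=> Bm; case: (AB m).
  - by move=> [_ []]; left.
have [Bm|nB] := pselect (B m).
  exists i1; split; first by rewrite F1.
  apply: ord3; rewrite ?F0 ?F1 ?F2 //.
  by move=> [_ []]; right.
exists i2; split; first by rewrite F2; split=> // -[].
by apply: ord3; rewrite ?F0 ?F1 ?F2 // => -[].
Qed.

Lemma partition_disjoint (A B S : set nat) :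
  is_partition (tnth [tuple A; B; S]) -> A `&` B = set0.
Proof.
move=> [sub uniq]; apply/seteqP; split=> // m [Am Bm].
have m0 : posnat m by exact: (sub 0).
have [i [_ iP]] := uniq m m0.
by have := iP 0 Am; rewrite (iP 1 Bm).
Qed.

Lemma seq_dist_max {R : realType} (u v : nat -> nat) (M : int) (n0 : nat) :
  (forall n, (0 < n)%N -> 0 <= (v n)%:Z - (u n)%:Z <= M) ->
  (0 < n0)%N -> (v n0)%:Z - (u n0)%:Z = M ->
  seq_dist R u v = (M%:~R)%:E.
Proof.
move=> bounds n0_gt0 attained.
have distE n : (0 < n)%N ->
    `|(u n)%:R - (v n)%:R| = ((v n)%:Z - (u n)%:Z)%:~R :> R.
  move=> /bounds/andP[d0 _]; rewrite distrC intrB ger0_norm//.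
  by rewrite -(ler0z R) intrB in d0.
apply/eqP; rewrite eq_le; apply/andP; split.
  apply: ub_ereal_sup => _ [n n_gt0 <-].
  by rewrite lee_fin distE// ler_int; case/andP: (bounds n n_gt0).
by apply: ereal_sup_ubound; exists n0 => //; rewrite distE// attained.
Qed.

Theorem theorem1 (R : realType) (alpha beta gamma : R)
    (alpha_gt0 : 0 < alpha) (beta_gt0 : 0 < beta) (gamma_gt0 : 0 < gamma)
    (alpha_irr : irrational alpha) (beta_irr : irrational beta)
    (gamma_irr : irrational gamma)
    (sum_eq1 : alpha + beta + gamma = 1) :
  let condition := exists r s : nat,
    [/\ (0 < r)%N, (0 < s)%N & r%:R * alpha + s%:R * beta = 1] in
  let rest := posnat `\` (beatty_set alpha `|` beatty_set beta) in
  let c := beatty gamma in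
  let M := max_deviation alpha beta in
  ((exists S : set nat, almost_beatty_set gamma S /\
      is_partition (tnth [tuple beatty_set alpha; beatty_set beta; S]))
     <-> condition)
  /\
  (condition ->
     [/\ beatty_set alpha `&` beatty_set beta = set0,
         almost_beatty_set gamma rest
       & forall ct : nat -> nat, enumerates rest ct ->
         [/\ seq_dist R ct c = (M%:~R)%:E,
             (forall n : nat, (0 < n)%N ->
                0 <= (c n)%:Z - (ct n)%:Z <= M),
             infinite_set
               [set n : nat | (0 < n)%N /\ (c n)%:Z - (ct n)%:Z = M]
           & Num.max alpha beta < 1 / 2 ->
             forall n : nat, (0 < n)%N ->
               (c n)%:Z - (ct n)%:Z \in [:: 0; 1; 2]]]).
Proof.
move=> condition rest c M.
have alpha_lt1 : alpha < 1 by lra.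
have beta_lt1 : beta < 1 by lra.
(* The irrationality of gamma enters here; it excludes r = s. *)
have sum_irr : irrational (alpha + beta).
  have -> : alpha + beta = 1 - gamma by lra.
  move=> [q _ qE]; apply: gamma_irr; exists (1 - q) => //.
  by rewrite rmorphB rmorph1 /= qE; lra.
have disj : condition -> beatty_set alpha `&` beatty_set beta = set0.
  by move=> [r [s [r0 s0 rel]]]; exact: (beatty_disjoint _ _ r s).
have dev : condition -> forall ct, enumerates rest ct ->
    [/\ seq_dist R ct c = (M%:~R)%:E,
        forall n, (0 < n)%N -> 0 <= (c n)%:Z - (ct n)%:Z <= M
      & infinite_set [set n | (0 < n)%N /\ (c n)%:Z - (ct n)%:Z = M]].
  move=> [r [s [r0 s0 rel]]] ct enum.
  have bounds n (n0 : (0 < n)%N) : 0 <= (c n)%:Z - (ct n)%:Z <= M.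
    exact: (deviation_le_max _ _ _ r s).
  have attained N : exists2 n, (N < n)%N & (c n)%:Z - (ct n)%:Z = M.
    exact: (deviation_max_attained _ _ _ r s).
  split=> //.
    have [n n0 nM] := attained 0%N.
    exact: (seq_dist_max _ _ _ n).
  apply: unbounded_infinite_set => N; have [n Nn nM] := attained N.
  by exists n; [exact: ltnW|split=> //; exact: leq_ltn_trans Nn].
have almost : condition -> almost_beatty_set gamma rest.
  move=> cond.
  have [|ct enum] := exists_enumerates_rest alpha beta alpha_gt0 alpha_irr
    beta_gt0 beta_irr _ (disj cond); first lra.
  have [dist _ _] := dev cond ct enum; have [incr val] := enum.
  exists ct => //; split=> //; first by rewrite val => m [].
  by rewrite dist ltry.
split; last first.
  move=> cond; split; [exact: disj|exact: almost|move=> ct enum].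
  have [dist bounds attained] := dev cond ct enum; split=> //.
  rewrite gt_max => /andP[a2 b2] n /bounds; rewrite /M /max_deviation.
  rewrite !floor_deviation_lt_half// maxxx !inE.
  by case: (_ - _) => // -[|[|[|]]].
split=> [[S [_ part]]|cond].
  (* The relation comes from the disjointness of the two exact Beatty sets. *)
  by apply: beatty_disjoint_relation => //; exact: partition_disjoint part.
exists rest; split; first exact: almost.
apply: is_partition_rest; [exact: beatty_set_posnat..|exact: disj].
Qed.
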